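(* Let $t_0>0$, assume that $T>t_0$ and that the system $x'+Ax=Bu$, $x(0)=x_0$ is nodal profile exactly controllable using $L^2$-controls in time $t_0$, with constant $C_1$ and with respect to the linear map $\Pi:L^2(0,T;X)\to L^2(t_0,T;Z)$. Let $x_d\in X$ be a holdable desired state with corresponding constant control $u_d\in U$. For $\gamma>0$ consider the problem $$\mathbf{S}(T,\gamma):\quad \min_{u\in L^2(0,T;U)}\ \tfrac12\,\|u-u_d\|^2_{L^2(0,T;U)}+\gamma\,\sqrt{\int_{t_0}^T\|\Pi x(s)-\Pi x_d\|_Z^2\,ds}\quad\text{subject to}\quad x'+Ax=Bu,\ x(0)=x_0 .$$ Let $v_{\rm exact}\in L^2(0,t_0;U)$ be a control which, extended by the constant control $u_d$ to $(t_0,T)$, generates a state $p_{\rm exact}$ with $p_{\rm exact}(0)=x_0$ and $\Pi p_{\rm exact}(t)=\Pi x_d$ for all $t\in[t_0,T]$. If $$\gamma> C_1\,\|v_{\rm exact}-u_d\|_{L^2(0,t_0;U)},$$ then the solution $(u_T,x_T)$ (optimal control and corresponding state) of $\mathbf{S}(T,\gamma)$ satisfies $$\Pi x_T(s)=\Pi x_d\qquad\text{for all } s\in[t_0,T].$$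
   Context: $X$, $U$ and $Z$ are Hilbert spaces with norms $\|\cdot\|_X$, $\|\cdot\|_U$, $\|\cdot\|_Z$. The operator $-A:\mathcal{D}(A)\subset X\to X$ generates a strongly continuous semigroup on $X$, and $B$ is an admissible control operator for it (in the standard sense: $B$ is bounded from $U$ into the extrapolation space $X_{-1}$ and the input-to-state maps take $L^2(0,t;U)$ boundedly into $X$), so that for every $T>0$, $x_0\in X$ and $u\in L^2(0,T;U)$ the Cauchy problem $x'+Ax=Bu$, $x(0)=x_0$ has a unique (mild) solution $x\in C([0,T];X)$. The initial state $x_0\in X$ is given. $\Pi:L^2(0,T;X)\to L^2(t_0,T;Z)$ is a given linear map; $\Pi x(t)$ means $(\Pi x)(t)$, $\Pi x_d$ means $\Pi$ applied to the constant function with value $x_d$, and equalities of such functions ''for all $t\in[t_0,T]$'' are understood as equalities in $L^2(t_0,T;Z)$. Nodal profile exact controllability using $L^2$-controls in time $t_0$: there is a constant $C_1>0$ such that for all initial states $x_0\in X$ and all nodal profiles $z\in L^2(t_0,T;Z)$ there is $u\in L^2(0,T;U)$ such that the solution $x\in C([0,T];X)$ of $x'+Ax=Bu$, $x(0)=x_0$ satisfies $\Pi x(t)=z(t)$ for all $t\in[t_0,T]$ and $\|u\|_{L^2(0,T;U)}\le C_1(\|x_0\|_X+\|z\|_{L^2(t_0,T;Z)})$. Holdable state: $x_d\in X$ is holdable with constant control $u_d\in U$ if the constant control $u_d$ keeps the state equal to $x_d$ once it has been reached, i.e. $Ax_d=Bu_d$ (in $X_{-1}$). In the norms $\|u-u_d\|$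 and $\|v_{\rm exact}-u_d\|$, $u_d$ is regarded as a constant function of time. *)

(* Defs.v *)
From HB Require Import structures.
From mathcomp Require Import all_boot all_order all_algebra.
From mathcomp Require Import all_classical all_reals all_analysis.

Set Implicit Arguments.
Unset Strict Implicit.
Unset Printing Implicit Defensive.

Import Order.TTheory GRing.Theory Num.Theory.
Import numFieldNormedType.Exports.

Local Open Scope classical_set_scope.
Local Open Scope ring_scope.

HB.mixin Record CompleteNormedModule_isHilbert (R : realType) H
    of CompleteNormedModule R H := {
  inner : H -> H -> R ;
  innerC : forall x y, inner x y = inner y x ;
  innerDl : forall x y z, inner (x + y) z = inner x z + inner y z ;
  innerZl : forall a x y, inner (a *: x) y = a * inner x y ;
  innerxx : forall x, inner x x = `|x| ^+ 2 }.

(* Real scalars; a complex Hilbert space is one of these through the real part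
   of its inner product, with the same norm. *)
#[short(type="hilbertType")]
HB.structure Definition Hilbert (R : realType) :=
  {H of CompleteNormedModule R H & CompleteNormedModule_isHilbert R H}.

Section bochner.
Context {R : realType} {V : normedModType R}.
Local Notation mu := (@lebesgue_measure R).
Implicit Types (a b : R) (f g : R -> V) (s : {fimfun R >-> V}).

Definition simple s := forall v, measurable (s @^-1` [set v]).

Definition strongly_measurable a b f :=
  exists s_ : nat -> {fimfun R >-> V}, (forall n, simple (s_ n)) /\
    {ae mu, forall t, t \in `[a, b] -> s_ n t @[n --> \oo] --> f t}.

Definition simple_integral a b s : V :=
  \sum_(v \in range s) fine (mu (`[a, b] `&` s @^-1` [set v])) *: v.

(* "The Bochner integral of f over [a, b] exists and equals v." *)
Definition has_bochner_integral a b f (v : V) :=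
  strongly_measurable a b f /\
  exists s_ : nat -> {fimfun R >-> V}, [/\ forall n, simple (s_ n),
    (\int[mu]_(t in `[a, b]) `|f t - s_ n t|%:E)%E @[n --> \oo] --> 0%E &
    simple_integral a b (s_ n) @[n --> \oo] --> v].

(* Elements of L^2(a, b; V) are represented by functions R -> V; two of them
   are identified when they satisfy eqL2, and their values off [a, b] are
   irrelevant. *)
Definition inL2 a b f :=
  strongly_measurable a b f /\
  (\int[mu]_(t in `[a, b]) (`|f t| ^+ 2)%:E < +oo)%E.

Definition eqL2 a b f g := {ae mu, forall t, t \in `[a, b] -> f t = g t}.

(* Meaningful when inL2 a b f; otherwise fine may return a junk value. *)
Definition normL2 a b f : R :=
  Num.sqrt (fine (\int[mu]_(t in `[a, b]) (`|f t| ^+ 2)%:E)%E).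

End bochner.

(* A linear map L^2(a, b; V) -> L^2(c, d; W), given on representatives. It is
   not required to be bounded. *)
Definition linearL2 {R : realType} {V W : normedModType R} (a b c d : R)
    (F : (R -> V) -> R -> W) :=
  [/\ forall f, inL2 a b f -> inL2 c d (F f),
      forall f g, inL2 a b f -> inL2 a b g -> eqL2 a b f g ->
        eqL2 c d (F f) (F g) &
      forall (k : R) f g, inL2 a b f -> inL2 a b g ->
        eqL2 c d (F (fun t => k *: f t + g t)) (fun t => k *: F f t + F g t)].

Section semigroup.
Context {R : realType} {X : normedModType R}.

(* The values of S at negative times are irrelevant. *)
Definition C0_semigroup (S : R -> {linear X -> X}) :=
  [/\ forall t, 0 <= t -> continuous (S t),
      forall x, S 0 x = x,
      forall s t x, 0 <= s -> 0 <= t -> S (s + t) x = S s (S t x) &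
      forall x, S t x @[t --> 0^'+] --> x].

(* G : X -> X with domain D is the generator of S; G is irrelevant off D. *)
Definition generator (S : R -> {linear X -> X}) (D : set X) (G : X -> X) :=
  (forall x, D x <-> cvg (h^-1 *: (S h x - x) @[h --> 0^'+])) /\
  (forall x, D x -> h^-1 *: (S h x - x) @[h --> 0^'+] --> G x).

(* Rb is a bounded inverse of beta - G : D -> X. *)
Definition resolvent (D : set X) (G : X -> X) (beta : R)
    (Rb : {linear X -> X}) :=
  [/\ continuous Rb,
      forall x, D (Rb x) /\ beta *: Rb x - G (Rb x) = x &
      forall y, D y -> Rb (beta *: y - G y) = y].

End semigroup.

(* Xe, with the embedding iota, is a completion of X for the norm
   x |-> `|(beta - G)^-1 x|, for some beta in the resolvent set of G. Different
   beta give equivalent norms on the same space. *)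
Definition extrapolation_space {R : realType} {X : normedModType R}
    {Xe : completeNormedModType R} (D : set X) (G : X -> X)
    (iota : {linear X -> Xe}) :=
  dense (range iota) /\
  exists beta (Rb : {linear X -> X}),
    resolvent D G beta Rb /\ forall x, `|iota x| = `|Rb x|.

Section control.
Context {R : realType} {X U : normedModType R} {Xe : completeNormedModType R}.
Variables (S : R -> {linear X -> X}) (D : set X) (A : X -> X).
Variables (iota : {linear X -> Xe}) (Se : R -> {linear Xe -> Xe}).
Variables (Ae : {linear X -> Xe}) (B : {linear U -> Xe}).

(* The continuous extensions to Xe of the operators S t and A; they are unique
   since iota has dense range and D is dense in X. *)
Definition semigroup_extension := forall t, 0 <= t ->
  continuous (Se t) /\ forall x, Se t (iota x) = iota (S t x).

Definition operator_extension :=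
  continuous Ae /\ forall x, D x -> Ae x = iota (A x).

(* K bounds the input-to-state map u |-> \int_0^t Se (t - s) B u(s) ds from
   L^2(0, t; U) to X. *)
Definition admissible := continuous B /\
  forall t, 0 < t -> exists K : R, forall u : R -> U, inL2 0 t u ->
    exists2 v : X,
      has_bochner_integral 0 t (fun s => Se (t - s) (B (u s))) (iota v) &
      `|v| <= K * normL2 0 t u.

(* x is the solution in C([0, T]; X) of x' + A x = B u, x(0) = x0, for the
   control u in L^2(0, T; U). *)
Definition mild_solution (T : R) (x0 : X) (u : R -> U) (x : R -> X) :=
  [/\ inL2 0 T u, {within `[0, T], continuous x} &
      forall t, 0 <= t <= T -> exists2 y : Xe,
        has_bochner_integral 0 t (fun s => Se (t - s) (B (u s))) y &
        iota (x t) = iota (S t x0) + y].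

Definition holdable (xd : X) (ud : U) := Ae xd = B ud.

Context {Z : normedModType R}.
Variable Pi : (R -> X) -> R -> Z.

Definition nodal_profile_controllable (t0 T C1 : R) :=
  0 < C1 /\
  forall (x0 : X) (z : R -> Z), inL2 t0 T z ->
    exists u x, [/\ mild_solution T x0 u x, eqL2 t0 T (Pi x) z &
      normL2 0 T u <= C1 * (`|x0| + normL2 t0 T z)].

Definition cost (t0 T gamma : R) (xd : X) (ud : U) (u : R -> U) (x : R -> X) :=
  2^-1 * normL2 0 T (fun t => u t - ud) ^+ 2 +
  gamma * normL2 t0 T (fun s => Pi x s - Pi (cst xd) s).

Definition optimal (t0 T gamma : R) (x0 xd : X) (ud : U)
    (u : R -> U) (x : R -> X) :=
  mild_solution T x0 u x /\
  forall u' x', mild_solution T x0 u' x' ->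
    cost t0 T gamma xd ud u x <= cost t0 T gamma xd ud u' x'.

End control.

(* The control v on [0, t0], followed by the constant ud. *)
Definition extend_control {R : realType} {U : Type} (t0 : R) (v : R -> U)
    (ud : U) : R -> U := fun t => if t <= t0 then v t else ud.

(* Main.v *)
(* Let z be the deviation of Pi xT from Pi xd. Controllability from the zero
   state gives, for every small e > 0, a control w of norm at most C1 e |z|
   whose state y satisfies Pi y = - e z. By linearity, uT + w is an admissible
   competitor with deviation (1 - e) z, so optimality yields
     gamma e |z| <= |uT - ud| e C1 |z| + O(e^2).
   Comparing with the exact control gives |uT - ud| <= |vexact - ud|. Letting e
   tend to 0, gamma |z| <= C1 |vexact - ud| |z|, which forces z = 0. *)

Require Import Defs.
From HB Require Import structures.
From mathcomp Require Import all_boot all_order all_algebra.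
From mathcomp Require Import all_classical all_reals all_analysis.
From mathcomp Require Import measurable_realfun finmap.
From mathcomp Require Import ring lra.

Set Implicit Arguments.
Unset Strict Implicit.
Unset Printing Implicit Defensive.

Import Order.TTheory GRing.Theory Num.Theory.
Import numFieldNormedType.Exports.

Local Open Scope classical_set_scope.
Local Open Scope ring_scope.

(** * Integrals of nonnegative functions up to null sets *)

Section lower_integral.
Local Open Scope ereal_scope.
Context d (T : measurableType d) (R : realType).
Variable mu : {measure set T -> \bar R}.
Import HBNNSimple.

(* Strongly measurable functions are measurable only off a null set, which need
   not be Borel on the whole interval; but the integral, a supremum over simple
   minorants, compares nonnegative functions off null sets even when they are
   not measurable. *)
Lemma le_integral_off_null (D N : set T) (f g : T -> \bar R) :
  measurable N -> mu N = 0 ->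
  (forall x, D x -> 0 <= f x) -> (forall x, D x -> 0 <= g x) ->
  (forall x, D x -> ~ N x -> f x <= g x) ->
  \int[mu]_(x in D) f x <= \int[mu]_(x in D) g x.
Proof.
move=> mN N0 f0 g0 fg.
rewrite !ge0_integralE//; apply: ge_ereal_sup => _ [h /= hf <-].
apply: le_ereal_sup_tmp.
(* A simple minorant [h] of [f], cut to zero on [N], keeps its integral and becomes a minorant of
   [g]. *)
exists (sintegral mu (proj_nnsfun h (measurableC mN))); last first.
  rewrite -!integralT_nnsfun (ge0_negligible_integral mN)//; last 2 first.
  - by apply/measurable_EFinP.
  - by move=> x _; rewrite lee_fin.
  rewrite setTD integral_mkcond; apply: ge0_le_integral => //.
  - by move=> x _; apply: erestrict_ge0 => y _; rewrite lee_fin.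
  - apply/(measurable_restrictT _ _).1; first exact: measurableC.
    by apply/measurable_EFinP; exact: measurable_funTS.
  - by apply/measurable_EFinP.
  move=> x _; rewrite patchE /= /proj_nnsfun /=.
  by rewrite mindicE; case: ifP => _; rewrite lee_fin ?mulr1 ?mulr0.
exists (proj_nnsfun h (measurableC mN)) => // x /=.
rewrite mindicE patchE; have := hf x; rewrite patchE.
case: ifPn => [/set_mem Dx|nDx].
  have [/set_mem/= xN hx|_ _] := boolP (x \in ~` N); last by rewrite mulr0 g0.
  by rewrite mulr1 (le_trans hx)// fg.
rewrite lee_fin => hx; rewrite lee_fin.
by rewrite mulr_le0_ge0// ler0n.
Qed.

Lemma eq_integral_off_null (D N : set T) (f g : T -> \bar R) :
  measurable N -> mu N = 0 ->
  (forall x, D x -> 0 <= f x) -> (forall x, D x -> 0 <= g x) ->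
  (forall x, D x -> ~ N x -> f x = g x) ->
  \int[mu]_(x in D) f x = \int[mu]_(x in D) g x.
Proof.
move=> mN N0 f0 g0 fg; apply/eqP; rewrite eq_le; apply/andP; split;
  by apply: le_integral_off_null mN N0 _ _ _ => // x Dx Nx; rewrite fg.
Qed.

(** In effect measurability for the completion of [mu], phrased with a measurable exceptional set so
    that the sigma-algebra of [T] is kept. *)
Definition ae_measurable (D : set T) (F : T -> R) :=
  exists N, [/\ measurable N, mu N = 0 & measurable_fun (D `\` N) F].

Lemma ae_measurable_comp D F (phi : R -> R) :
  measurable_fun setT phi -> ae_measurable D F -> ae_measurable D (phi \o F).
Proof.
move=> mphi [N [mN N0 mF]]; exists N; split => //.
exact: measurableT_comp.
Qed.

(** Linearity of the integral needs measurable integrands, so [F] and [G] are first set to zero on a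
    common null set. [H] carries no measurability and enters only through monotonicity off that
    set. *)
Lemma ge0_le_integral_lin D (F G H : T -> R) (p q : R) : measurable D ->
  ae_measurable D F -> ae_measurable D G -> (0 <= p)%R -> (0 <= q)%R ->
  (forall x, 0 <= F x)%R -> (forall x, 0 <= G x)%R ->
  (forall x, D x -> 0 <= H x <= p * F x + q * G x)%R ->
  \int[mu]_(x in D) (H x)%:E <=
    p%:E * \int[mu]_(x in D) (F x)%:E + q%:E * \int[mu]_(x in D) (G x)%:E.
Proof.
move=> mD [M [mM M0 mF]] [N [mN N0 mG]] p0 q0 F0 G0 HFG.
pose K := M `|` N; have mK : measurable K by exact: measurableU.
have K0 : mu K = 0 by exact: null_set_setU.
have offK (L : T -> R) : (forall x, D x -> 0 <= L x)%R ->
    \int[mu]_(x in D) (L x)%:E =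
    \int[mu]_(x in D) (patch (fun=> 0%R) (~` K) L x)%:E.
  move=> L0; apply: (eq_integral_off_null mK K0) => x Dx.
  - by rewrite lee_fin L0.
  - by rewrite lee_fin patchE; case: ifPn => //; rewrite L0.
  - by move=> Kx; rewrite patchE mem_set.
have mres (L : T -> R) : measurable_fun (D `\` K) L ->
    measurable_fun D (fun x => (patch (fun=> 0%R) (~` K) L x)%:E).
  move=> mL; apply/measurable_EFinP.
  by apply/measurable_restrict => //; exact: measurableC.
have {}mF : measurable_fun (D `\` K) F.
  apply: measurable_funS mF; first exact: measurableD.
  by apply: setDS; exact: subsetUl.
have {}mG : measurable_fun (D `\` K) G.
  apply: measurable_funS mG; first exact: measurableD.
  by apply: setDS; exact: subsetUr.
have res0 (L : T -> R) : (forall x, 0 <= L x)%R ->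
    forall x, D x -> 0 <= (patch (fun=> 0%R) (~` K) L x)%:E.
  by move=> L0 x _; rewrite lee_fin patchE; case: ifPn.
rewrite (offK F)// (offK G)//.
rewrite -ge0_integralZl//; [|exact: mres|exact: res0].
rewrite -ge0_integralZl//; [|exact: mres|exact: res0].
rewrite -ge0_integralD//.
- apply: (le_integral_off_null mK K0) => x Dx.
  + by rewrite lee_fin; case/andP: (HFG x Dx).
  + by rewrite adde_ge0// mule_ge0// res0.
  + move=> Kx; rewrite !patchE mem_set//= -!EFinM -EFinD lee_fin.
    by case/andP: (HFG x Dx).
- by move=> x Dx; rewrite mule_ge0// res0.
- by apply: measurable_funeM; exact: mres.
- by move=> x Dx; rewrite mule_ge0// res0.
- by apply: measurable_funeM; exact: mres.
Qed.

(** Cut to zero on its null set, [F] becomes measurable with the same integral, and the classical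
    vanishing criterion applies. *)
Lemma ae_measurable_integral_eq0 D (F : T -> R) : measurable D ->
  ae_measurable D F -> (forall x, 0 <= F x)%R ->
  \int[mu]_(x in D) (F x)%:E = 0 -> {ae mu, forall x, D x -> F x = 0%R}.
Proof.
move=> mD [N [mN N0 mF]] F0 int0.
have mF' : measurable_fun D (fun x => (patch (fun=> 0%R) (~` N) F x)%:E).
  by apply/measurable_EFinP/measurable_restrict => //; exact: measurableC.
have int0' : \int[mu]_(x in D) `|(patch (fun=> 0%R) (~` N) F x)%:E| = 0.
  rewrite -int0; apply: (eq_integral_off_null mN N0) => x Dx.
  - exact: abse_ge0.
  - by rewrite lee_fin.
  - by move=> Nx; rewrite patchE mem_set//= ger0_norm.
have [K [mK K0 subK]] := (ae_eq_integral_abs mu mD mF').1 int0'.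
exists (N `|` K); split; [exact: measurableU|exact: null_set_setU|].
move=> x /= /not_implyP[Dx Fx0]; have [Nx|Nx] := pselect (N x); first by left.
right; apply: subK => /= /(_ Dx); rewrite patchE mem_set// => -[].
exact: Fx0.
Qed.

End lower_integral.

(** * Simple functions and their integrals *)

Section simple_functions.
Context {R : realType}.
Local Notation mu := (@lebesgue_measure R).
Implicit Types (V W : normedModType R).

(** Since [s] has finitely many values, the preimage is a finite union of measurable fibres,
    whatever the set [A]. *)
Lemma simple_preimage V (s : {fimfun R >-> V}) (A : set V) :
  simple s -> measurable (s @^-1` A).
Proof.
move=> ms; have -> : s @^-1` A = \bigcup_(v in range s `&` A) s @^-1` [set v].
  apply/seteqP; split=> [t At|t [v [_ Av] /= ->//]].
  by exists (s t) => //; split => //; exists t.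
apply: fin_bigcup_measurable => //.
exact: finite_setIl.
Qed.

Lemma simple_comp V W (phi : V -> W) (s : {fimfun R >-> V}) :
  simple s -> simple (phi \o s).
Proof. by move=> ms v; exact: (simple_preimage (phi @^-1` [set v]) ms). Qed.

(** The level sets of the pair form the common refinement of those of [s] and [s']. A named function
    can carry the finite-image instance. *)
Definition fun_pair V W (s : R -> V) (s' : R -> W) t := (s t, s' t).

Fact fun_pair_fimfun V W (s : {fimfun R >-> V}) (s' : {fimfun R >-> W}) :
  @FiniteImage R (V * W)%type (fun_pair s s').
Proof.
split; apply: (@sub_finite_set _ _ (range s `*` range s')).
  by move=> _ [t _ <-]; split; exists t.
exact: finite_setX.
Qed.
HB.instance Definition _ V W s s' := @fun_pair_fimfun V W s s'.

Lemma simple_pair V W (s : {fimfun R >-> V}) (s' : {fimfun R >-> W}) :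
  simple s -> simple s' -> simple [fimfun of fun_pair s s'].
Proof.
move=> ms ms' [v w]; have -> : fun_pair s s' @^-1` [set (v, w)] =
    s @^-1` [set v] `&` s' @^-1` [set w].
  by apply/seteqP; split=> [t [<- <-]//|t [/= <- <-]].
exact: measurableI.
Qed.

(** Each level set of [phi \o s] is the disjoint union of the level sets of [s] over it, so the
    values of [s] can be grouped by their image. This allows integration over a partition finer than
    the one a simple function defines. *)
Lemma simple_integral_comp V W (phi : V -> W) (s : {fimfun R >-> V}) a b :
  simple s ->
  simple_integral a b (phi \o s) =
  \sum_(v \in range s) fine (mu (`[a, b] `&` s @^-1` [set v])) *: phi v.
Proof.
move=> ms; rewrite /simple_integral !fsbig_finite//.
rewrite (fset_set_comp setT s phi).
rewrite [RHS](partition_big_imfset _ phi)/=; apply: eq_bigr => w _.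
transitivity ((\sum_(v <- fset_set (range s) | phi v == w)
  fine (mu (`[a, b] `&` s @^-1` [set v]))) *: w); last first.
  by rewrite scaler_suml; apply: eq_bigr => v /eqP ->.
congr (_ *: w).
pose F v := `[a, b] `&` s @^-1` [set v].
have mF v : measurable (F v) by exact: measurableI.
(* [fine] commutes with the sum of measures only when these are finite, which boundedness of the
   interval ensures. *)
have Ffin v : mu (F v) \is a fin_num.
  rewrite ge0_fin_numE// (@le_lt_trans _ _ (mu `[a, b]))//.
    apply: le_measure; last exact: subIsetl.
    - by apply/mem_set; exact: mF.
    - by apply/mem_set.
  by rewrite lebesgue_measure_itv/=; case: ifP => _; rewrite -?EFinB ltry.
have -> : `[a, b] `&` (phi \o s) @^-1` [set w] =
    \big[setU/set0]_(v <- [fset v in fset_set (range s) | phi v == w]%fset)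
      F v.
  rewrite -bigcup_fset; apply/seteqP; split=> [t [abt /= phiw]|t].
    exists (s t) => //=; rewrite !inE phiw eqxx andbT.
    by rewrite in_fset_set//; apply/mem_set; exists t.
  by move=> [v /=]; rewrite !inE => /andP[_ /eqP <-] [abt /= <-].
rewrite measure_fbigsetU//; last 2 first.
- by move=> v _; exact: mF.
- by move=> v v' _ _ [t [[_ /= <-] [_ /= <-]]].
rewrite [RHS]big_fset_condE -sum_fine//= => v _; exact: Ffin.
Qed.

End simple_functions.

(** * Strong measurability and the L^2 seminorm *)

Section L2.
Context {R : realType}.
Local Notation mu := (@lebesgue_measure R).
Context {V : normedModType R}.
Implicit Types (a b k : R) (f g : R -> V).

Lemma ae_imp2 (P Q S : R -> Prop) : (forall t, P t -> Q t -> S t) ->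
  {ae mu, forall t, P t} -> {ae mu, forall t, Q t} -> {ae mu, forall t, S t}.
Proof. exact: (@filterS2 _ _ (ae_filter_ringOfSetsType mu)). Qed.

Lemma ae_imp (P Q : R -> Prop) : (forall t, P t -> Q t) ->
  {ae mu, forall t, P t} -> {ae mu, forall t, Q t}.
Proof. exact: (@filterS _ _ (ae_filter_ringOfSetsType mu)). Qed.

Lemma strongly_measurable_simple a b (s : {fimfun R >-> V}) :
  simple s -> strongly_measurable a b s.
Proof.
by move=> ms; exists (fun=> s); split=> //; apply/aeW => t _; exact: cvg_cst.
Qed.

Lemma strongly_measurable_lin a b k f g :
  strongly_measurable a b f -> strongly_measurable a b g ->
  strongly_measurable a b (fun t => k *: f t + g t).
Proof.
move=> [s_ [ms sf]] [s'_ [ms' sg]].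
pose lin (p : V * V) := k *: p.1 + p.2.
exists (fun n => [fimfun of lin \o fun_pair (s_ n) (s'_ n)]); split.
  by move=> n; apply: simple_comp; exact: simple_pair.
apply: ae_imp2 sf sg => t sf sg tab.
apply: cvgD; last exact: sg.
by apply: cvgZr; exact: sf.
Qed.

(** The norms of the simple approximants are measurable and converge pointwise off the exceptional
    null set, which serves as [N]. *)
Lemma ae_measurable_norm a b f :
  strongly_measurable a b f -> ae_measurable mu `[a, b] (fun t => `|f t|).
Proof.
move=> [s_ [ms [N [mN N0 sN]]]]; exists N; split => //.
apply: (@measurable_fun_cvg _ _ _ _ (fun n t => `|s_ n t|)).
  move=> n mD Y mY; apply: measurableI => //.
  exact: (simple_preimage ((fun v => `|v|) @^-1` Y) (ms n)).
move=> t [/= tab Nt]; apply: cvg_norm.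
by apply: contrapT => h; apply: Nt; apply: sN => /= /(_ tab).
Qed.

Lemma ae_measurable_norm2 a b f : strongly_measurable a b f ->
  ae_measurable mu `[a, b] (fun t => `|f t| ^+ 2).
Proof.
move=> /ae_measurable_norm.
apply: (ae_measurable_comp (phi := fun x => x ^+ 2)).
exact: exprn_measurable.
Qed.

Lemma normL2_ge0 a b f : 0 <= normL2 a b f. Proof. exact: sqrtr_ge0. Qed.

Lemma sqr_normL2 a b f : inL2 a b f ->
  (\int[mu]_(t in `[a, b]) (`|f t| ^+ 2)%:E)%E = (normL2 a b f ^+ 2)%:E.
Proof.
move=> [_ ffin]; rewrite sqr_sqrtr.
  by rewrite fineK// ge0_fin_numE// integral_ge0// => t _; rewrite lee_fin.
by rewrite fine_ge0// integral_ge0// => t _; rewrite lee_fin.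
Qed.

Lemma normL2_le a b f (c : R) : 0 <= c ->
  (\int[mu]_(t in `[a, b]) (`|f t| ^+ 2)%:E <= (c ^+ 2)%:E)%E ->
  normL2 a b f <= c.
Proof.
move=> c0 le; rewrite -[leRHS](ger0_norm c0) -sqrtr_sqr ler_wsqrtr//.
rewrite -lee_fin fineK// ge0_fin_numE ?integral_ge0//.
by rewrite (le_lt_trans le)// ltry.
Qed.

(* The weights come from [2 x y <= (q / p) x^2 + (p / q) y^2]; they are optimal
   when [p : q] is the ratio of the norms of [k f] and [g]. *)
Lemma integral_sqr_lin a b k f g (p q : R) :
  strongly_measurable a b f -> strongly_measurable a b g -> 0 < p -> 0 < q ->
  (\int[mu]_(t in `[a, b]) (`|k *: f t + g t| ^+ 2)%:E <=
   ((1 + q / p) * k ^+ 2)%:E * \int[mu]_(t in `[a, b]) (`|f t| ^+ 2)%:E +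
   (1 + p / q)%:E * \int[mu]_(t in `[a, b]) (`|g t| ^+ 2)%:E)%E.
Proof.
move=> mf mg p0 q0.
have pq0 : 0 <= q / p by rewrite ltW// divr_gt0.
have qp0 : 0 <= p / q by rewrite ltW// divr_gt0.
apply: ge0_le_integral_lin => //; try exact: ae_measurable_norm2.
- by rewrite mulr_ge0 ?addr_ge0 ?sqr_ge0.
- by rewrite addr_ge0.
move=> t _; rewrite sqr_ge0/=.
have le1 : `|k *: f t + g t| <= `|k| * `|f t| + `|g t|.
  by rewrite -normrZ ler_normD.
apply: (@le_trans _ _ ((`|k| * `|f t| + `|g t|) ^+ 2)).
  by rewrite ler_sqr ?nnegrE// addr_ge0// mulr_ge0.
set x := `|f t|; set y := `|g t|.
rewrite -(real_normK (num_real k)); set l := `|k|.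
rewrite -subr_ge0.
have -> : (1 + q / p) * l ^+ 2 * x ^+ 2 + (1 + p / q) * y ^+ 2 -
    (l * x + y) ^+ 2 = (q * (l * x) - p * y) ^+ 2 / (p * q).
  by field; rewrite !gt_eqF.
by rewrite divr_ge0 ?sqr_ge0// mulr_ge0// ltW.
Qed.

Lemma inL2_lin a b k f g : inL2 a b f -> inL2 a b g ->
  inL2 a b (fun t => k *: f t + g t).
Proof.
move=> Lf Lg; have [[mf _] [mg _]] := (Lf, Lg).
split; first exact: strongly_measurable_lin.
apply: le_lt_trans (integral_sqr_lin k mf mg ltr01 ltr01) _.
by rewrite !sqr_normL2// -!EFinM -EFinD ltry.
Qed.

Lemma normL2_lin_le a b k f g : inL2 a b f -> inL2 a b g ->
  normL2 a b (fun t => k *: f t + g t) <= `|k| * normL2 a b f + normL2 a b g.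
Proof.
move=> Lf Lg; have [[mf _] [mg _]] := (Lf, Lg).
set al := `|k| * _; set be := normL2 a b g.
have al0 : 0 <= al by rewrite mulr_ge0// normL2_ge0.
have be0 : 0 <= be by exact: normL2_ge0.
apply/ler_addgt0Pr => e e0.
have e20 : 0 < e / 2 by rewrite divr_gt0.
(* The ideal weights are [al] and [be]; the margin [e / 2] keeps them positive when a norm
   vanishes. *)
pose p := al + e / 2; pose q := be + e / 2.
have p0 : 0 < p by rewrite ltr_wpDl.
have q0 : 0 < q by rewrite ltr_wpDl.
have -> : al + be + e = p + q by rewrite /p /q; field.
apply: normL2_le; first by rewrite addr_ge0// ltW.
apply: le_trans (integral_sqr_lin k mf mg p0 q0) _.
rewrite !sqr_normL2// -!EFinM -EFinD lee_fin.
have -> : (1 + q / p) * k ^+ 2 * normL2 a b f ^+ 2 = (1 + q / p) * al ^+ 2.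
  by rewrite /al exprMn real_normK ?num_real ?mulrA.
have -> : (p + q) ^+ 2 = (1 + q / p) * p ^+ 2 + (1 + p / q) * q ^+ 2.
  by field; rewrite !gt_eqF.
apply: lerD; apply: ler_wpM2l.
- by rewrite addr_ge0// ltW// divr_gt0.
- by rewrite ler_sqr ?nnegrE ?(ltW p0)// lerDl ltW.
- by rewrite addr_ge0// ltW// divr_gt0.
- by rewrite ler_sqr ?nnegrE ?(ltW q0)// lerDl ltW.
Qed.

Lemma eq_normL2 a b f g : eqL2 a b f g -> normL2 a b f = normL2 a b g.
Proof.
move=> [N [mN N0 sN]]; congr (Num.sqrt (fine _)).
apply: (eq_integral_off_null mN N0) => t tab; rewrite ?lee_fin//.
move=> Nt; congr ((`|_| ^+ 2)%:E); apply: contrapT => h; apply: Nt.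
by apply: sN => /= /(_ tab).
Qed.

Lemma normL2_eq0 a b f : inL2 a b f -> normL2 a b f = 0 -> eqL2 a b f (cst 0).
Proof.
move=> Lf f0; have [mf _] := Lf.
have intf0 : (\int[mu]_(t in `[a, b]) (`|f t| ^+ 2)%:E = 0)%E.
  by rewrite sqr_normL2// f0 expr0n.
have := ae_measurable_integral_eq0 _ (ae_measurable_norm2 mf) _ intf0.
move=> /(_ (measurable_itv _) (fun=> sqr_ge0 _)).
apply: ae_imp => t h tab; apply/eqP.
by rewrite -normr_eq0 -sqrf_eq0; apply/eqP; apply: h.
Qed.

End L2.

(** * Additivity of the Bochner integral *)

Section bochner.
Context {R : realType}.
Local Notation mu := (@lebesgue_measure R).
Context {V : normedModType R}.
Implicit Types (a b k : R) (f g : R -> V).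

(** All three integrals become sums over the range of the pair, where they add term by term. *)
Lemma simple_integralD a b (s s' : {fimfun R >-> V}) : simple s -> simple s' ->
  simple_integral a b ((fun p => p.1 + p.2) \o fun_pair s s') =
  simple_integral a b s + simple_integral a b s'.
Proof.
move=> ms ms'; have mp := simple_pair ms ms'.
have -> : simple_integral a b s = simple_integral a b (fst \o fun_pair s s').
  by congr simple_integral; apply/fimfuneqP.
have -> : simple_integral a b s' = simple_integral a b (snd \o fun_pair s s').
  by congr simple_integral; apply/fimfuneqP.
rewrite !(simple_integral_comp _ _ _ mp) -fsbig_split//=.
by apply: eq_fsbigr => p _; rewrite scalerDr.
Qed.

(** The sums of the approximants work: their L^1 error is squeezed between zero and the sum of the
    two errors. *)
Lemma has_bochner_integralD a b f g (v w : V) :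
  has_bochner_integral a b f v -> has_bochner_integral a b g w ->
  has_bochner_integral a b (fun t => f t + g t) (v + w).
Proof.
move=> [mf [s_ [ms sf sv]]] [mg [s'_ [ms' sg sw]]]; split.
  have := strongly_measurable_lin 1 mf mg.
  by congr strongly_measurable; apply/funext => t; rewrite scale1r.
exists (fun n => [fimfun of (fun p => p.1 + p.2) \o fun_pair (s_ n) (s'_ n)]).
split.
- by move=> n; apply: simple_comp; exact: simple_pair.
- have := cvgeD (isT : (0 +? 0)%E) sf sg; rewrite adde0.
  move=> /(_ eventually_filter) sfg.
  refine (squeeze_cvge _ (cvg_cst (0%E : \bar R)) sfg).
  apply: nearW => n; rewrite integral_ge0/=; last first.
    by move=> t _; rewrite lee_fin.
  have mB h (s : {fimfun R >-> V}) : strongly_measurable a b h -> simple s ->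
      ae_measurable mu `[a, b] (fun t => `|h t - s t|).
    move=> mh /strongly_measurable_simple => /(_ a b) mse.
    have := strongly_measurable_lin (-1) mse mh.
    move=> /ae_measurable_norm.
    by congr ae_measurable; apply/funext => t; rewrite scaleN1r addrC.
  have := ge0_le_integral_lin (mu := mu)
    (H := fun t => `|f t + g t - (s_ n t + s'_ n t)|)
    _ (mB _ _ mf (ms n)) (mB _ _ mg (ms' n)) ler01 ler01.
  rewrite !mul1e; apply => //= t _.
  by rewrite !mul1r normr_ge0/= opprD addrACA ler_normD.
- rewrite (_ : (fun n => _) =
    fun n => simple_integral a b (s_ n) + simple_integral a b (s'_ n)).
    exact: cvgD.
  by apply/funext => n; rewrite simple_integralD.
Qed.

End bochner.

(** * Continuous functions on a compact interval are in L^2 *)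

Section continuous_L2.
Context {R : realType} {V : normedModType R}.
Local Notation mu := (@lebesgue_measure R).
Variables (a b : R) (x : R -> V).
Hypothesis cx : {within `[a, b], continuous x}.

Import HBNNSimple.

(** [x] is sampled at [a + r_ n t], where the simple functions [r_ n] approximate [t - a] from
    below; the samples converge by continuity. *)
Lemma continuous_strongly_measurable : strongly_measurable a b x.
Proof.
have mid : measurable_fun `[a, b] (fun t => (t - a)%:E).
  by apply/measurable_EFinP; exact: measurable_funB.
pose r_ := nnsfun_approx (measurable_itv `[a, b]) mid.
have pos t : `[a, b]%classic t -> (0 <= (t - a)%:E)%E.
  by rewrite /= in_itv/= lee_fin subr_ge0 => /andP[].
have rt t : `[a, b]%classic t -> r_ n t @[n --> \oo] --> t - a.
  move=> tab.
  by have /fine_cvgP[] := cvg_nnsfun_approx (measurable_itv _) mid pos tab.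
have rle t n : `[a, b]%classic t -> r_ n t <= t - a.
  by move=> tab; rewrite -lee_fin nnsfun_approxE le_approx.
exists (fun n => [fimfun of (fun y => x (a + y)) \o (r_ n : R -> R)]); split.
  move=> n; apply: simple_comp => y.
  exact: measurable_sfunP.
apply: aeW => t tab /=.
have tab' : `[a, b]%classic t by [].
move/subspace_continuousP : cx => /(_ t tab') cxt.
apply: cvg_comp cxt.
have rta : a + r_ n t @[n --> \oo] --> t.
  by rewrite -[X in _ --> X](subrKC a); apply: cvgD; [exact: cvg_cst|exact: rt].
move=> P /= tP.
(* Continuity holds only within the interval, so the sample points must stay in it; this follows
   from [0 <= r_ n t <= t - a]. *)
have : \forall n \near \oo, `[a, b]%classic (a + r_ n t) -> P (a + r_ n t).
  exact: rta _ tP.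
apply: filterS => n; apply=> /=.
rewrite in_itv/= lerDl fun_ge0/=; move: tab; rewrite in_itv/= => /andP[_ tb].
by rewrite (le_trans _ tb)// -lerBrDl rle.
Qed.

(** The norm attains a maximum on the compact interval, so the integrand is bounded on a set of
    finite measure. The case [b < a] is an empty integral. *)
Lemma continuous_inL2 : inL2 a b x.
Proof.
split; first exact: continuous_strongly_measurable.
have [ab|ba] := leP a b; last first.
  by rewrite set_itv_ge ?integral_set0 ?ltry// -ltNge.
have cnx : {within `[a, b], continuous (fun t => `|x t|)}.
  by move=> t; apply: cvg_norm; exact: cx.
have [c cab xc] := EVT_max ab cnx.
apply: (@le_lt_trans _ _ (\int[mu]_(t in `[a, b]) (`|x c| ^+ 2)%:E)%E).
  apply: (le_integral_off_null measurable0 (measure0 _)) => t tab.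
  - by rewrite lee_fin.
  - by rewrite lee_fin.
  - by move=> _; rewrite lee_fin ler_sqr ?nnegrE// xc.
rewrite integral_cst//= lebesgue_measure_itv/= lte_fin.
by case: ifP => _; rewrite ?mule0 -?EFinB -?EFinM ltry.
Qed.

End continuous_L2.

(** * Special cases of the L^2 estimates *)

Section L2_norm.
Context {R : realType} {V : normedModType R}.
Implicit Types (a b k : R) (f g : R -> V).

Lemma inL2D a b f g :
  inL2 a b f -> inL2 a b g -> inL2 a b (fun t => f t + g t).
Proof.
move=> Lf Lg; have := inL2_lin 1 Lf Lg.
by congr inL2; apply/funext => t; rewrite scale1r.
Qed.

Lemma inL2B a b f g :
  inL2 a b f -> inL2 a b g -> inL2 a b (fun t => f t - g t).
Proof.
move=> Lf Lg; have := inL2_lin (-1) Lg Lf.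
by congr inL2; apply/funext => t; rewrite scaleN1r addrC.
Qed.

Lemma inL2_cst a b (v : V) : inL2 a b (cst v).
Proof.
apply: continuous_inL2; apply: continuous_subspaceT => t; exact: cvg_cst.
Qed.

Lemma normL2D_le a b f g :
  inL2 a b f -> inL2 a b g ->
  normL2 a b (fun t => f t + g t) <= normL2 a b f + normL2 a b g.
Proof.
move=> Lf Lg; have := normL2_lin_le 1 Lf Lg; rewrite normr1 mul1r.
by congr (normL2 _ _ _ <= _); apply/funext => t; rewrite scale1r.
Qed.

Lemma normL2_cst0 a b : normL2 a b (cst (0 : V)) = 0.
Proof.
by rewrite /normL2 integral0_eq ?sqrtr0// => t _; rewrite normr0 expr0n.
Qed.

Lemma normL2Z_le a b k f : inL2 a b f ->
  normL2 a b (fun t => k *: f t) <= `|k| * normL2 a b f.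
Proof.
move=> Lf; have := normL2_lin_le k Lf (inL2_cst a b 0).
rewrite normL2_cst0 addr0.
by congr (normL2 _ _ _ <= _); apply/funext => t; rewrite addr0.
Qed.

End L2_norm.

(** After [t0] the deviation from [ud] is zero, so both integrands have the same extension by zero
    to the real line. *)
Lemma normL2_extend_control {R : realType} {U : normedModType R}
    (t0 T : R) (v : R -> U) (ud : U) : t0 <= T ->
  normL2 0 T (fun t => extend_control t0 v ud t - ud) =
  normL2 0 t0 (fun t => v t - ud).
Proof.
move=> t0T; congr (Num.sqrt (fine _)).
rewrite integral_mkcond [RHS]integral_mkcond; congr integral.
apply/funext => t; rewrite !patchE /extend_control !mem_setE !in_itv/=.
case: (leP 0 t) => //= _.
have [tt0|t0t] := leP t t0; first by rewrite (le_trans tt0 t0T).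
by rewrite subrr normr0 expr0n/=; case: ifP.
Qed.

(** * Superposition of mild solutions *)

Section control.
Context {R : realType} {X U : normedModType R} {Xe : completeNormedModType R}.
Variables (S : R -> {linear X -> X}) (iota : {linear X -> Xe}).
Variables (Se : R -> {linear Xe -> Xe}) (B : {linear U -> Xe}).

Lemma mild_solutionD T x0 y0 u w x y :
  mild_solution S iota Se B T x0 u x -> mild_solution S iota Se B T y0 w y ->
  mild_solution S iota Se B T (x0 + y0)
    (fun t => u t + w t) (fun t => x t + y t).
Proof.
move=> [Lu cx sx] [Lw cy sy]; split.
- exact: inL2D.
- exact: (within_continuousD cx cy).
move=> t tT; have [p ip xp] := sx t tT; have [q iq yq] := sy t tT.
exists (p + q); last first.
  rewrite /= linearD xp yq [S t (_ + _)]linearD.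
  by rewrite [iota (_ + _)]linearD addrACA.
have := has_bochner_integralD ip iq.
congr has_bochner_integral; apply/funext => s.
by rewrite [B (_ + _)]linearD [RHS]linearD.
Qed.

End control.

(** * Exactness of the norm penalty *)

Theorem theorem3 (R : realType) (X U Z : hilbertType R)
    (S : R -> {linear X -> X}) (D : set X) (A : X -> X)
    (Xe : completeNormedModType R) (iota : {linear X -> Xe})
    (Se : R -> {linear Xe -> Xe}) (Ae : {linear X -> Xe})
    (B : {linear U -> Xe}) (Pi : (R -> X) -> R -> Z)
    (t0 T C1 gamma : R) (x0 xd : X) (ud : U)
    (vexact : R -> U) (pexact : R -> X) (uT : R -> U) (xT : R -> X) :
  C0_semigroup S ->
  generator S D (fun x => - A x) ->
  extrapolation_space D (fun x => - A x) iota ->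
  semigroup_extension S iota Se ->
  operator_extension D A iota Ae ->
  admissible iota Se B ->
  0 < t0 -> t0 < T ->
  linearL2 0 T t0 T Pi ->
  nodal_profile_controllable S iota Se B Pi t0 T C1 ->
  holdable Ae B xd ud ->
  0 < gamma ->
  inL2 0 t0 vexact ->
  mild_solution S iota Se B T x0 (extend_control t0 vexact ud) pexact ->
  eqL2 t0 T (Pi pexact) (Pi (cst xd)) ->
  C1 * normL2 0 t0 (fun t => vexact t - ud) < gamma ->
  optimal S iota Se B Pi t0 T gamma x0 xd ud uT xT ->
  eqL2 t0 T (Pi xT) (Pi (cst xd)).
Proof.
move=> _ _ _ _ _ _ t0_gt0 t0T [PiL2 _ Pilin] [C1_gt0 ctrl] _ gamma_gt0 _.
move=> exact_sol Pi_exact gammaC1 [solT optT].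
have [LuT cxT _] := solT.
have LxT := continuous_inL2 cxT.
have Lxd : inL2 t0 T (Pi (cst xd)) by apply: PiL2; exact: inL2_cst.
have LPiT : inL2 t0 T (Pi xT) by exact: PiL2.
pose z t := Pi xT t - Pi (cst xd) t.
have Lz : inL2 t0 T z by exact: inL2B.
have Lud : inL2 0 T (fun t => uT t - ud) by apply: inL2B => //; exact: inL2_cst.
set a := normL2 0 T (fun t => uT t - ud).
set m := normL2 0 t0 (fun t => vexact t - ud) in gammaC1.
set zeta := normL2 t0 T z.
have [a0 m0 zeta0] : [/\ 0 <= a, 0 <= m & 0 <= zeta].
  by split; exact: normL2_ge0.
(* The exact control pays no penalty, so optimality gives
   [a ^+ 2 / 2 + gamma * zeta <= m ^+ 2 / 2]. *)
have a_le_m : a <= m.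
  have := optT _ _ exact_sol.
  rewrite /cost (normL2_extend_control _ _ (ltW t0T)) -/a -/m -/zeta.
  have -> : normL2 t0 T (fun s => Pi pexact s - Pi (cst xd) s) = 0.
    rewrite (@eq_normL2 _ _ _ _ _ (cst 0)).
      by rewrite normL2_cst0.
    by apply: ae_imp Pi_exact => t h tT; rewrite h// subrr.
  rewrite mulr0 addr0 => h.
  rewrite -ler_sqr ?nnegrE//.
  have : 0 <= gamma * zeta by rewrite mulr_ge0// ltW.
  by move: h; lra.
(* Optimality against the perturbed control bounds [a ^+ 2 / 2 + gamma * zeta] by [(a + e * (C1 *
   zeta)) ^+ 2 / 2 + gamma * (1 - e) * zeta]; cancelling and dividing by [e] gives the claim. *)
have descent e : 0 < e -> e <= 1 ->
    gamma * zeta <= C1 * a * zeta + e * (C1 * zeta) ^+ 2 / 2.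
  move=> e0 e1.
  have Lez : inL2 t0 T (fun t => - e *: z t).
    have := inL2_lin (- e) Lz (inL2_cst t0 T 0).
    by congr inL2; apply/funext => t; rewrite addr0.
  (* Starting from the zero state leaves the initial state [x0] of the sum unchanged. *)
  have [w [y [soly Piy wle]]] := ctrl 0 _ Lez.
  have [Lw cy _] := soly.
  have Ly := continuous_inL2 cy.
  have {}wle : normL2 0 T w <= e * (C1 * zeta).
    rewrite (le_trans wle)// normr0 add0r mulrCA.
    apply: ler_wpM2l; first exact: ltW.
    by have := normL2Z_le (- e) Lz; rewrite normrN gtr0_norm//.
  have := mild_solutionD solT soly; rewrite addr0 => solTy.
  have := optT _ _ solTy; rewrite /cost -/a -/zeta.
  have ule : normL2 0 T (fun t => uT t + w t - ud) <= a + e * (C1 * zeta).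
    apply: (le_trans _ (lerD (lexx a) wle)).
    have := normL2D_le Lud Lw.
    by congr (normL2 _ _ _ <= _); apply/funext => t; rewrite addrAC.
  have xle : normL2 t0 T (fun t => Pi (fun s => xT s + y s) t - Pi (cst xd) t)
      <= (1 - e) * zeta.
    rewrite (@eq_normL2 _ _ _ _ _ (fun t => (1 - e) *: z t)).
      by have := normL2Z_le (1 - e) Lz; rewrite ger0_norm// subr_ge0.
    have := Pilin 1 _ _ LxT Ly.
    under [X in Pi X]eq_fun do rewrite scale1r.
    apply: ae_imp2 Piy => t Piyt Pit tT.
    by rewrite Pit// Piyt// scale1r addrAC -/(z t) scalerBl scale1r scaleNr.
  have u0 := normL2_ge0 0 T (fun t => uT t + w t - ud).
  have usq : normL2 0 T (fun t => uT t + w t - ud) ^+ 2 <=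
      (a + e * (C1 * zeta)) ^+ 2.
    by rewrite ler_sqr ?nnegrE// (le_trans u0 ule).
  have gx := ler_wpM2l (ltW gamma_gt0) xle.
  move=> opt; rewrite -(ler_pM2l e0).
  by move: opt usq gx; lra.
have zeta_eq0 : zeta = 0.
  apply/eqP; rewrite eq_le zeta0 andbT leNgt; apply/negP => zeta_gt0.
  (* With this [c] the second-order term of [descent] is [e * c * zeta], so [zeta] can be divided
     out. *)
  pose c := C1 ^+ 2 * zeta / 2.
  have c0 : 0 < c by rewrite divr_gt0// mulr_gt0// exprn_gt0.
  pose g := gamma - C1 * m.
  have g0 : 0 < g by rewrite subr_gt0.
  (* This makes [e * c] at most half the gap [g], whence [gamma <= C1 * m + g / 2 < gamma], a
     contradiction. *)
  pose e := Num.min 1 (g / (2 * c)).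
  have e0 : 0 < e by rewrite lt_min ltr01 divr_gt0// mulr_gt0.
  have e1 : e <= 1 by rewrite ge_min lexx.
  have ec : e * c <= g / 2.
    have : e * c <= g / (2 * c) * c.
      by rewrite ler_wpM2r ?(ltW c0)// ge_min lexx orbT.
    by rewrite (_ : g / (2 * c) * c = g / 2)//; field; rewrite gt_eqF.
  have := descent e e0 e1.
  have -> : C1 * a * zeta + e * (C1 * zeta) ^+ 2 / 2 = (C1 * a + e * c) * zeta.
    by rewrite /c; field.
  rewrite ler_pM2r//.
  have := ler_wpM2l (ltW C1_gt0) a_le_m.
  by move: g0 ec; rewrite /g; lra.
apply: ae_imp (normL2_eq0 Lz zeta_eq0) => t h tT.
by apply/eqP; rewrite -subr_eq0; apply/eqP; exact: h.
Qed.
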